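(* Let $M$ be a gasket automaton satisfying the $\gamma$-isolated condition with $\mathcal P_{\alpha\gamma}\cup\mathcal P_{\beta\gamma}\ne\emptyset$, and let $M'$ be a one-step simplification of $M$ determined by the pair $(\tau,\kappa)$. Let $\Omega=\{\omega\kappa^\infty:\omega\in\Sigma^*\}$. Then there exists a bijection $g:\Omega\to\Omega$ such that for all $\mathbf x,\mathbf y\in\Omega$, $|T_M(\mathbf x,\mathbf y)-T_{M'}(g(\mathbf x),g(\mathbf y))|\le5$.
   Context: $\Sigma=\{1,\dots,N\}$, $\Sigma^*$ the finite words, $\Sigma^\infty$ the infinite words; $\kappa^\infty=\kappa\kappa\kappa\cdots$. A $\Sigma$-automaton $M$ has finite state set $Q=Q_0\cup\{Id,Exit\}$, input alphabet $\Sigma^2$, initial state $Id$, final state $Exit$, transition $\delta:Q\times\Sigma^2\to Q$ with $\delta(Id,(i,j))=Id$ iff $i=j$. Itinerary of $(\mathbf x,\mathbf y)$: $S_0=Id$, $S_k=\delta(S_{k-1},(x_k,y_k))$, stopped at $Exit$; $T_M(\mathbf x,\mathbf y)$ = largest $k$ with $S_k\neq Exit$ (possibly $\infty$). Triangle automaton: $\alpha,\beta,\gamma$ distinct elements of $\Sigma\cup\{-1,-2,-3\}$; $Q=\{S_{uv}:u\neq v\in\{\alpha,\beta,\gamma\}\}\cup\{Id,Exit\}$; $\delta(Id,(i,j))=S_{uv}\Rightarrow\delta(Id,(j,i))=S_{vu}$; $\delta(S_{uv},(i,j))=S_{uv}$ if $(i,j)=(v,u)$, else $Exit$. $\mathcal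 P_{uv}=\{(i,j):\delta(Id,(i,j))=S_{uv}\}$, $i\triangleleft_{uv}j$ iff $(i,j)\in\mathcal P_{uv}$ (iff $j\triangleleft_{vu}i$); $j$ is $uv$-minimal if no $i\triangleleft_{uv}j$, $uv$-maximal if no $j\triangleleft_{uv}k$, $uv$-isolated if both. A triangle automaton is determined by $\mathcal P_{\alpha\beta},\mathcal P_{\alpha\gamma},\mathcal P_{\beta\gamma}$. Gasket automaton: triangle automaton with (Uniqueness) $i\triangleleft_{uv}j,i\triangleleft_{uv}j'\Rightarrow j=j'$; (Gathering) any two of $a\triangleleft_{\alpha\gamma}c$, $a\triangleleft_{\beta\gamma}b$, $b\triangleleft_{\alpha\beta}c$ imply the third; (Boundary) if $\alpha\in\Sigma$ it is $\alpha\gamma$- and $\alpha\beta$-minimal; if $\beta\in\Sigma$ it is $\beta\gamma$- and $\beta\alpha$-minimal; if $\gamma\in\Sigma$ it is $\gamma\alpha$- and $\gamma\beta$-minimal. $\gamma$-isolated condition: $\alpha,\beta,\gamma\in\Sigma$; the directed graph $(\Sigma,\mathcal P_{\alpha\gamma}\cup\mathcal P_{\beta\gamma})$ has no directed cycle; $\gamma$ is $\alpha\gamma$-, $\beta\gamma$- and $\alpha\beta$-isolated. One-step simplification: $b$ is double-maximal if $\alpha\gamma$-maximal and $\beta\gamma$-maximal. Choose $(\tau,\kappa)\in\mathcal P_{\alpha\gamma}\cup\mathcal P_{\beta\gamma}$ with $\kappa$ double-maximal. If $(\tau,\kappa)\in\mathcal P_{\alpha\gamma}$: if $\kappa$ has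 no $\alpha\beta$-predecessor, $\mathcal P'_{\alpha\beta}=\mathcal P_{\alpha\beta}$, $\mathcal P'_{\alpha\gamma}=\mathcal P_{\alpha\gamma}\setminus\{(\tau,\kappa)\}$, $\mathcal P'_{\beta\gamma}=\mathcal P_{\beta\gamma}$; if $\lambda\triangleleft_{\alpha\beta}\kappa$, then $\mathcal P'_{\alpha\beta}=\mathcal P_{\alpha\beta}$, $\mathcal P'_{\alpha\gamma}=\mathcal P_{\alpha\gamma}\setminus\{(\tau,\kappa)\}$, $\mathcal P'_{\beta\gamma}=\mathcal P_{\beta\gamma}\setminus\{(\tau,\lambda)\}$. If $(\tau,\kappa)\in\mathcal P_{\beta\gamma}$, the same with $\alpha$ and $\beta$ interchanged. $M'$ is the triangle automaton determined by $\mathcal P'_{\alpha\beta},\mathcal P'_{\alpha\gamma},\mathcal P'_{\beta\gamma}$. *)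

(* Defs.v *)
From mathcomp Require Import all_boot.
From Stdlib Require Import ClassicalEpsilon.
Set Implicit Arguments. Unset Strict Implicit. Unset Printing Implicit Defensive.

(* Alphabet Sigma = {1,...,N} is represented by 'I_N (letter k <-> k+1).
   Extended letters Sigma u {-1,-2,-3}: inl a is a letter of Sigma,
   inr k (k : 'I_3) stands for -(k+1). *)
Definition ext_letter (N : nat) := ('I_N + 'I_3)%type.

(* Infinite words x = x_1 x_2 ... are functions nat -> 'I_N with x_{k+1} = x k. *)
Definition word (N : nat) := nat -> 'I_N.

Record triangle (N : nat) := Triangle {
  t_alpha : ext_letter N;
  t_beta  : ext_letter N;
  t_gamma : ext_letter N;
  P_ab : rel 'I_N;
  P_ag : rel 'I_N;
  P_bg : rel 'I_N }.

Definition pos N (M : triangle N) (u : 'I_3) : ext_letter N :=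
  match val u with 0 => t_alpha M | 1 => t_beta M | _ => t_gamma M end.

Definition P N (M : triangle N) (u v : 'I_3) : rel 'I_N :=
  fun i j =>
  match val u, val v with
  | 0, 1 => P_ab M i j | 1, 0 => P_ab M j i
  | 0, 2 => P_ag M i j | 2, 0 => P_ag M j i
  | 1, 2 => P_bg M i j | 2, 1 => P_bg M j i
  | _, _ => false
  end.

(* The data define a genuine triangle automaton: alpha, beta, gamma distinct,
   no diagonal pair (i,i) in any P_uv (delta(Id,(i,i)) = Id), and the P_uv for
   distinct ordered pairs (u,v) pairwise disjoint (delta(Id,.) is a function). *)
Definition triangle_ok N (M : triangle N) : Prop :=
  [/\ t_alpha M <> t_beta M, t_alpha M <> t_gamma M, t_beta M <> t_gamma M,
      (forall u v i, ~~ P M u v i i) &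
      (forall u v u' v' i j, P M u v i j -> P M u' v' i j -> u = u' /\ v = v')].

Inductive tstate := Id | Exit | St of 'I_3 & 'I_3.

Definition is_exit (s : tstate) : bool := if s is Exit then true else false.

Definition delta N (M : triangle N) (s : tstate) (i j : 'I_N) : tstate :=
  match s with
  | Id => if i == j then Id else
          match [pick uv : 'I_3 * 'I_3 | P M uv.1 uv.2 i j] with
          | Some uv => St uv.1 uv.2
          | None => Exit
          end
  | Exit => Exit
  | St u v => if (pos M v == inl i) && (pos M u == inl j) then St u v else Exit
  end.

Fixpoint run N (M : triangle N) (x y : word N) (k : nat) : tstate :=
  match k with
  | 0 => Id
  | k'.+1 => delta M (run M x y k') (x k') (y k')
  end.

(* T_M(x,y) = largest k with S_k <> Exit; None stands for infinity.
   Since Exit is absorbing and S_0 = Id, this is the least n with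
   S_{n+1} = Exit. *)
Definition T N (M : triangle N) (x y : word N) : option nat :=
  match excluded_middle_informative (exists n, is_exit (run M x y n.+1)) with
  | left H => Some (ex_minn H)
  | right _ => None
  end.

Definition dist_le (a b : option nat) (d : nat) : Prop :=
  match a, b with
  | None, None => True
  | Some m, Some n => (m <= n + d) && (n <= m + d)
  | _, _ => False
  end.

Definition gasket N (M : triangle N) : Prop :=
  [/\
      (forall u v i j j', u != v -> P M u v i j -> P M u v i j' -> j = j'),
      (forall a b c : 'I_N,
          [/\ (P_ag M a c -> P_bg M a b -> P_ab M b c),
              (P_ag M a c -> P_ab M b c -> P_bg M a b) &
              (P_bg M a b -> P_ab M b c -> P_ag M a c)]) &
      [/\ (forall a, t_alpha M = inl a ->
             (forall i, ~~ P_ag M i a) /\ (forall i, ~~ P_ab M i a)),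
          (forall b, t_beta M = inl b ->
             (forall i, ~~ P_bg M i b) /\ (forall i, ~~ P_ab M b i)) &
          (forall c, t_gamma M = inl c ->
             (forall i, ~~ P_ag M c i) /\ (forall i, ~~ P_bg M c i))]].

Definition isolated N (R : rel 'I_N) (j : 'I_N) : Prop :=
  (forall i, ~~ R i j) /\ (forall k, ~~ R j k).

Definition gamma_isolated N (M : triangle N) : Prop :=
  exists a b c : 'I_N,
  [/\ t_alpha M = inl a, t_beta M = inl b, t_gamma M = inl c,
      (forall (i : 'I_N) (p : seq 'I_N),
          ~~ cycle [rel i j | P_ag M i j || P_bg M i j] (i :: p)) &
      [/\ isolated (P_ag M) c, isolated (P_bg M) c & isolated (P_ab M) c]].

Definition double_maximal N (M : triangle N) (k : 'I_N) : Prop :=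
  (forall j, ~~ P_ag M k j) /\ (forall j, ~~ P_bg M k j).

Definition simplify N (M : triangle N) (tau kappa : 'I_N) : triangle N :=
  if P_ag M tau kappa then
    Triangle (t_alpha M) (t_beta M) (t_gamma M) (P_ab M)
      [rel i j | P_ag M i j && ~~ ((i == tau) && (j == kappa))]
      [rel i j | P_bg M i j && ~~ ((i == tau) && P_ab M j kappa)]
  else
    Triangle (t_alpha M) (t_beta M) (t_gamma M) (P_ab M)
      [rel i j | P_ag M i j && ~~ ((i == tau) && P_ab M kappa j)]
      [rel i j | P_bg M i j && ~~ ((i == tau) && (j == kappa))].

Definition in_Omega N (kappa : 'I_N) (x : word N) : Prop :=
  exists n, forall k, n <= k -> x k = kappa.

(* Main.v *)
(* Say that corner [v] of the piece [i] is glued to corner [u] of the piece [j]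
   when [P_uv i j].  Then [T] measures the common prefix of two words followed by
   a pair of glued letters and the two constant runs towards the glued corners,
   and by uniqueness and gathering [simplify] removes exactly the gluings of the
   gamma-corner of tau.  Let a be the corner of kappa glued to it.  The words
   tau gamma^m are close to kappa a^m in [M] but no longer in [M'], so they must be
   moved next to kappa a^m.  Room is made by the words kappa a^l kappa: the
   gamma-corner of kappa is free, so for each length at least 3 the words
     tau gamma^(m+2), kappa a^m kappa gamma, kappa a^(m-1) kappa gamma^2, ...,
     kappa kappa gamma^(m+1)
   can be permuted cyclically.  Doing this for every maximal run of gamma in a
   word preserves lengths, so the errors do not accumulate along the word: after
   removal of the equal initial blocks only a bounded error remains.
   Surjectivity holds because the words equal to kappa from rank n on form a
   finite set mapped injectively into itself. *)
Require Import Defs.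
From mathcomp Require Import all_boot zify.
From Stdlib Require Import ClassicalEpsilon FunctionalExtensionality.
Set Implicit Arguments. Unset Strict Implicit. Unset Printing Implicit Defensive.

(** * Closeness of words *)

Section Closeness.
Variable L : eqType.
Implicit Types (x y : nat -> L) (S : L -> L -> L -> L -> Prop).

Definition agree x y n := forall i, i < n -> x i = y i.

(** An automaton-free form of the statement that the first [K] letter pairs do not lead to [Exit]: a
    common prefix, possibly followed by one glued pair and then two constant runs towards the glued
    corners. *)
Definition close S x y K :=
  agree x y K \/
  exists n p q, [/\ n < K, agree x y n, x n <> y n, S (x n) p (y n) q &
                    forall i, n < i < K -> x i = p /\ y i = q].

Definition shift n x : nat -> L := fun i => x (n + i).

Lemma close0 S x y : close S x y 0.
Proof. by left. Qed.

Lemma close_at0 S x y K p q :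
  x 0 <> y 0 -> S (x 0) p (y 0) q ->
  (forall i, 0 < i < K -> x i = p /\ y i = q) -> close S x y K.
Proof.
move=> d0 Spq runs; case: K runs => [|K] runs; first exact: close0.
by right; exists 0, p, q; split.
Qed.

(** The place of the glued pair can only be the first difference of the two words. *)
Lemma close_diff S x y K n :
  close S x y K -> agree x y n -> x n <> y n -> n < K ->
  exists p q, S (x n) p (y n) q /\ forall i, n < i < K -> x i = p /\ y i = q.
Proof.
move=> clK ag nn nK; case: clK => [agK|[m [p [q [mK agm nm Sm runs]]]]].
  by case: nn; apply: agK.
have -> : n = m.
  case: (ltngtP n m) => [nm'|mn|//]; first by case: nn; apply: agm.
  by case: nm; apply: ag.
by exists p, q.
Qed.

Lemma close_head S x y K :
  close S x y K.+1 -> x 0 <> y 0 ->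
  exists p q, S (x 0) p (y 0) q /\ forall i, 0 < i <= K -> x i = p /\ y i = q.
Proof. by move=> cl d0; apply: (close_diff cl) => // i; rewrite ltn0. Qed.

(** Removing a common prefix costs exactly its length. This is what keeps errors from accumulating
    along a word. *)
Lemma close_shift S x y n K :
  agree x y n -> close S x y (n + K) <-> close S (shift n x) (shift n y) K.
Proof.
move=> ag; split=> [] [agK|[m [p [q [mK agm nm Sm runs]]]]].
- by left=> i iK; apply: agK; rewrite ltn_add2l.
- have nm' : n <= m by case: leqP => // mn; case: nm; apply: ag.
  right; exists (m - n), p, q; rewrite /shift subnKC //; split=> //.
  + by lia.
  + by move=> i iK; apply: agm; lia.
  + by move=> i iK; apply: runs; lia.
- left=> i iK; case: (ltnP i n) => [/ag//|ni].
  by have := agK (i - n); rewrite /shift subnKC //; apply; lia.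
- right; exists (n + m), p, q; split=> //; first by lia.
    move=> i im; case: (ltnP i n) => [/ag//|ni].
    by have := agm (i - n); rewrite /shift subnKC //; apply; lia.
  move=> i im; have := runs (i - n); rewrite /shift subnKC; first by apply; lia.
  by lia.
Qed.

Lemma close_sym S x y K :
  (forall i p j q, S i p j q -> S j q i p) -> close S x y K -> close S y x K.
Proof.
move=> Ssym [agK|[m [p [q [mK agm nm Sm runs]]]]].
  by left=> i /agK.
right; exists m, q, p; split=> //.
- by move=> i /agm.
- by move=> /esym.
- exact: Ssym.
- by move=> i /runs[].
Qed.

Lemma agree_close S x y n k : agree x y n -> k <= n -> close S x y k.
Proof. by move=> ag kn; left=> i ik; apply: ag; lia. Qed.

Lemma eq_close S x x' y y' k : (forall i, x i = x' i) -> (forall i, y i = y' i) ->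
  close S x y k -> close S x' y' k.
Proof.
move=> xx yy [ag|[n [p [q [nk ag d Sp runs]]]]].
  by left=> i ik; rewrite -xx -yy ag.
right; exists n, p, q; rewrite -xx -yy; split=> // i ik; rewrite -xx -yy; first exact: ag.
exact: runs.
Qed.

Lemma close_sub S S' x y K :
  (forall i p j q, S i p j q -> S' i p j q) -> close S x y K -> close S' x y K.
Proof.
move=> SS [ag|[n [p [q [nk ag d Sp runs]]]]]; first by left.
by right; exists n, p, q; split=> //; apply: SS.
Qed.

End Closeness.

(** * The rearrangement map *)

Section Rearrangement.
Variables (L : eqType) (tau kappa a c : L).
Hypotheses (a_kappa : a <> kappa) (tau_kappa : tau <> kappa).
Hypotheses (c_a : c <> a) (c_kappa : c <> kappa) (c_tau : c <> tau).
Implicit Types (x y : nat -> L) (S : L -> L -> L -> L -> Prop).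

(* [c] is gamma and [a] is alpha or beta.  [D m] codes the word
   [tau c^(m+2)] and [E l m] the word [kappa a^l kappa c^(m+1)]. *)
Inductive token := D of nat | E of nat & nat.

Definition len s := match s with D m => m.+3 | E l m => (l + m).+3 end.

Definition src s i :=
  match s with
  | D _ => if i == 0 then tau else c
  | E l _ => if (i == 0) || (i == l.+1) then kappa
             else if i <= l then a else c
  end.

(* On the tokens of a given length this is a cyclic permutation. *)
Definition phi s :=
  match s with D m => E m 0 | E 0 m => D m | E l.+1 m => E l m.+1 end.

Lemma len_phi s : len (phi s) = len s.
Proof. by case: s => [m|[|l] m] /=; lia. Qed.

(** The last condition makes the final run of [c] in the token maximal. *)
Definition starts s x := (forall i, i < len s -> x i = src s i) /\ x (len s) <> c.

(** The part of a token [E l m] that does not depend on [m]. *)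
Definition Estart l x :=
  [/\ x 0 = kappa, forall i, 0 < i <= l -> x i = a, x l.+1 = kappa & x l.+2 = c].

Lemma starts_D m x : starts (D m) x ->
  [/\ x 0 = tau, forall i, 0 < i < m.+3 -> x i = c & x m.+3 <> c].
Proof.
move=> [st nc]; split=> //; first by rewrite st.
by move=> i im; rewrite st /= ?gtn_eqF //; lia.
Qed.

Lemma starts_E l m x : starts (E l m) x ->
  [/\ Estart l x, forall i, l.+1 < i < (l + m).+3 -> x i = c & x (l + m).+3 <> c].
Proof.
move=> [st nc].
have cs i : l.+1 < i < (l + m).+3 -> x i = c.
  by move=> im; rewrite st /=; last lia; repeat case: ifP => //; lia.
split=> //; split; first by rewrite st.
- by move=> i im; rewrite st /=; last lia; repeat case: ifP => //; lia.
- by rewrite st /= ?eqxx ?orbT //; lia.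
- by apply: cs; lia.
Qed.

(** The second [kappa] of the shorter start would fall on a letter [a] of the longer one. *)
Lemma Estart_inj l l' x : Estart l x -> Estart l' x -> l = l'.
Proof.
wlog lt : l l' / l < l'.
  move=> W e e'; case: (ltngtP l l') => // lt; first exact: (W _ _ lt).
  by apply/esym; apply: (W _ _ lt).
by move=> [_ _ xk _] [_ xa _ _]; case: a_kappa; rewrite -xk xa //; lia.
Qed.

(** Only finite prefixes are excluded here, with no reference to where the run of [c] ends. *)
Definition plain x :=
  ~ [/\ x 0 = tau, x 1 = c & x 2 = c] /\ forall l, ~ Estart l x.

(** A token needs its run of [c] to end, so a tail constantly equal to [c] has to be excluded. Words
    of Omega escape because [c <> kappa]. *)
Definition escapes x := forall n, exists m, n <= m /\ x m <> c.

Lemma escapes_shift n x : escapes x -> escapes (shift n x).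
Proof.
move=> ex k; have [m [km xm]] := ex (n + k); exists (m - n).
by rewrite /shift subnKC; [split=> //|]; lia.
Qed.

Lemma run_end x n : escapes x ->
  exists m, [/\ n <= m, x m <> c & forall i, n <= i < m -> x i = c].
Proof.
move=> ex.
have exb : exists m, (n <= m) && (x m != c).
  by have [m [nm /eqP xm]] := ex n; exists m; rewrite nm.
case: (ex_minnP exb) => m /andP[nm /eqP xm] mmin; exists m; split=> // i im.
apply/eqP; apply/negP => /negP xi; have := mmin i; rewrite xi andbT; lia.
Qed.

Lemma plain_no_token x : escapes x -> (forall s, ~ starts s x) -> plain x.
Proof.
move=> ex nos; split=> [[x0 x1 x2]|l [x0 xa xk xc]].
  have [m [nm xm xi]] := run_end 1 ex.
  have m3 : 2 < m by case: m {xi} nm xm => [|[|[|m]]] //; congruence.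
  apply: (nos (D (m - 3))); split=> /= [i im|]; last first.
    by have -> : (m - 3).+3 = m by lia.
  by case: eqP => [->//|i0]; apply: xi; lia.
have [m [nm xm xi]] := run_end l.+2 ex.
have m3 : l.+2 < m by rewrite ltn_neqAle nm andbT; apply/eqP; congruence.
apply: (nos (E l (m - l.+3))); split=> /= [i im|]; last first.
  by have -> : (l + (m - l.+3)).+3 = m by lia.
case: eqP => [->//|i0] /=; case: eqP => [->//|i1] /=.
by case: leqP => il; [apply: xa|apply: xi]; lia.
Qed.

(** * Construction of the map and the prefixes and runs that it respects *)

Definition token_at x : option token :=
  match excluded_middle_informative (exists s, starts s x) with
  | left H => Some (proj1_sig (constructive_indefinite_description _ H))
  | right _ => None
  end.

Lemma token_atS x s : token_at x = Some s -> starts s x.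
Proof.
rewrite /token_at; case: excluded_middle_informative => // H [<-].
by case: constructive_indefinite_description.
Qed.

Lemma token_atN x s : token_at x = None -> ~ starts s x.
Proof.
by rewrite /token_at; case: excluded_middle_informative => // H _ st; apply: H; exists s.
Qed.

(* The first argument is fuel: [m.+1] steps determine the letter at [m]. *)
Fixpoint rearr_fuel f x m : L :=
  if f is f'.+1 then
    match token_at x with
    | Some s => if m < len s then src (phi s) m
                else rearr_fuel f' (shift (len s) x) (m - len s)
    | None => if m is m'.+1 then rearr_fuel f' (shift 1 x) m' else x 0
    end
  else x m.

Lemma rearr_fuelE f x m : m < f -> rearr_fuel f x m = rearr_fuel m.+1 x m.
Proof.
move: {2}f (leqnn f) => b; elim: b f x m => [|b IH] [|f] x m //= fb mf.
case: token_at => [s|].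
  case: ltnP => // sm.
  have s0 : 0 < len s by case: s {sm}.
  by rewrite IH; [rewrite [RHS]IH //|..]; lia.
by case: m mf => // m mf; rewrite IH.
Qed.

Definition rearr x m := rearr_fuel m.+1 x m.

Lemma rearr_token s x i : token_at x = Some s -> i < len s ->
  rearr x i = src (phi s) i.
Proof. by rewrite /rearr /= => -> ->. Qed.

Lemma rearr_token_shift s x i : token_at x = Some s ->
  rearr x (len s + i) = rearr (shift (len s) x) i.
Proof.
rewrite {1}/rearr /= => ->; rewrite ltnNge leq_addr /= addKn rearr_fuelE //.
by case: s => [m|l m] /=; lia.
Qed.

Lemma rearr_head x : token_at x = None -> rearr x 0 = x 0.
Proof. by rewrite /rearr /= => ->. Qed.

Lemma rearr_tail x i : token_at x = None -> rearr x i.+1 = rearr (shift 1 x) i.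
Proof. by rewrite {1}/rearr [rearr_fuel _ _ _]/= => ->. Qed.

(** Every token begins with [tau] or [kappa], so the map never creates an initial [c]. Hence a
    maximal run of [c] in a token is not prolonged by what follows it. *)
Lemma rearr_c x : rearr x 0 = c -> x 0 = c.
Proof.
case tx: (token_at x) => [s|]; last by rewrite rearr_head.
rewrite (rearr_token tx); last by case: s tx.
by case: s tx => [m|[|l] m] tx /=; congruence.
Qed.

Lemma rearr_starts s x : token_at x = Some s -> starts (phi s) (rearr x).
Proof.
move=> tx; split=> [i|]; rewrite len_phi; first exact: rearr_token.
have [_ nc] := token_atS tx.
by rewrite -[len s]addn0 (rearr_token_shift _ tx) => /rearr_c; rewrite /shift addn0.
Qed.

Lemma starts_nonconstant s x p : starts s x -> ~ forall i, i < 3 -> x i = p.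
Proof.
move=> st xp; move: (xp 0 isT) (xp 1 isT) (xp 2 isT).
case: s st => [m /starts_D[x0 xc _]|[|l] m /starts_E[[x0 xa xk xc] _ _]].
- by rewrite x0 (xc 1) //; congruence.
- by rewrite xk xc; congruence.
- by rewrite x0 (xa 1) //; congruence.
Qed.

(** The first three letters of a token are not all equal, so a token can begin only at one of the
    last two places of a constant run. Two letters are lost at most. *)
Lemma rearr_run x p r :
  (forall i, i < r.+2 -> x i = p) -> forall i, i < r -> rearr x i = p.
Proof.
elim: r x => // r IH x xp.
case tx: (token_at x) => [s|].
  by case: (starts_nonconstant (p := p) (token_atS tx)) => i i3; apply: xp; lia.
case=> [_|i ir]; first by rewrite rearr_head // xp.
by rewrite rearr_tail //; apply: IH => // j jr; apply: xp.
Qed.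

Lemma run_rearr x p r :
  (forall i, i < r.+2 -> rearr x i = p) -> forall i, i < r -> x i = p.
Proof.
elim: r x => // r IH x xp.
case tx: (token_at x) => [s|].
  by case: (starts_nonconstant (p := p) (rearr_starts tx)) => i i3; apply: xp; lia.
case=> [_|i ir]; first by rewrite -(rearr_head tx) xp.
apply: (IH (shift 1 x)) => // j jr.
by rewrite -(rearr_tail _ tx) xp.
Qed.

(** No token begins in a way compatible with [a^l kappa c], so such a prefix of the image is copied
    letter by letter. *)
Lemma rearr_prefix l x :
  (forall i, i < l -> rearr x i = a) -> rearr x l = kappa -> rearr x l.+1 = c ->
  [/\ forall i, i < l -> x i = a, x l = kappa & x l.+1 = c].
Proof.
elim: l x => [|l IH] x xa xk xc; case tx: (token_at x) => [s|].
- move/rearr_starts: tx; case: (phi s) => [m|[|l] m].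
  + by case/starts_D; congruence.
  + by case/starts_E=> -[]; congruence.
  + by case/starts_E=> -[_ /(_ 1 isT)]; congruence.
- by split=> //; [rewrite -(rearr_head tx)|
    apply: (@rearr_c (shift 1 x)); rewrite -(rearr_tail _ tx)].
- have := rearr_starts tx; case: (phi s) => [m|l' m].
    (* [tau] and [a] may coincide, so the second letter [c] is used to rule out this token. *)
    case/starts_D => x0 /(_ 1 isT) x1; case: l {IH} xa xk xc => [|l] xa xk xc.
      by congruence.
    by have := xa 1 isT; congruence.
  by case/starts_E => -[]; have := xa 0 isT; congruence.
case: (IH (shift 1 x)); rewrite -?(rearr_tail _ tx) //.
  by move=> i il; rewrite -(rearr_tail _ tx) xa.
move=> ya yk yc; split=> // -[|i] il; last exact: ya.
by rewrite -(rearr_head tx) xa.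
Qed.

(* What remains of the relation between [x] and [rearr x] when [x] does not
   begin with a token; this form is symmetric in both words. *)
Definition similar x y :=
  [/\ x 0 = y 0, plain x, plain y,
      forall p r, (forall i, 0 < i < r.+3 -> x i = p) -> forall i, 0 < i <= r -> y i = p &
      forall p r, (forall i, 0 < i < r.+3 -> y i = p) -> forall i, 0 < i <= r -> x i = p].

Lemma rearr_similar x : escapes x -> token_at x = None -> similar x (rearr x).
Proof.
move=> ex tx.
have [nD nE] : plain x by apply: plain_no_token => // s; apply: token_atN.
split=> //; first by rewrite rearr_head.
- split=> [[x0 x1 x2]|l [x0 xa xk xc]].
    apply: nD; rewrite -(rearr_head tx) x0.
    move: x1; rewrite (rearr_tail _ tx) => x1; have x1' := rearr_c x1.
    split=> //; move: x2; rewrite (rearr_tail _ tx).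
    case t1: (token_at (shift 1 x)) => [s|].
      move/rearr_starts: t1; case: (phi s) => [m|l m].
        by case/starts_D; congruence.
      by case/starts_E => -[]; congruence.
    by rewrite rearr_tail // => /rearr_c.
  apply: (nE l); rewrite (rearr_head tx) in x0.
  case: (@rearr_prefix l (shift 1 x)); rewrite -?(rearr_tail _ tx) //.
    by move=> i il; rewrite -(rearr_tail _ tx) xa.
  by move=> ya yk yc; split=> // -[//|i] il; apply: ya.
- move=> p r xp [//|i] ir; rewrite rearr_tail //.
  by apply: (@rearr_run _ p r) => // j jr; apply: xp; lia.
- move=> p r xp [//|i] ir.
  apply: (@run_rearr (shift 1 x) p r) => // j jr.
  by rewrite -(rearr_tail _ tx); apply: xp; lia.
Qed.

(** * Distortion *)

(* [S i p j q]: corner [p] of the piece [i] is glued to corner [q] of the piece [j]. *)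
Record gluing S : Prop := Gluing {
  glue_sym : forall i p j q, S i p j q -> S j q i p;
  glue_irr : forall i p j q, S i p j q -> i <> j;
  glue_corner : forall i p j q, S i p j q -> i <> p;
  glue_c : forall i p j q, S i p j q -> i <> c;
  glue_kappa : forall j q, ~ S kappa c j q }.

(** The letter [c] is glued to nothing, so closeness cannot pass a first difference that involves
    it. *)
Lemma close_c S x y K n : gluing S -> close S x y K -> agree x y n ->
  x n = c -> y n <> c -> K <= n.
Proof.
move=> gS cl ag xn yn; case: leqP => // nK.
have [p [q [Sp _]]] : exists p q, S (x n) p (y n) q /\
    forall i, n < i < K -> x i = p /\ y i = q.
  by apply: close_diff ag _ nK => //; congruence.
by case: (glue_c gS Sp).
Qed.

(** Let [d] be the first difference. Inside the run of [a] the next letter repeats [a], against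
    [glue_corner]; at its end the distinct letters [kappa] and [c] follow; at the second [kappa] the
    free corner [c] would be needed; at [c] nothing is glued. So closeness ends at most two letters
    after [d], which leaves two of the five letters for the run estimates in [similar]. *)
Lemma Estart_close S x y l n : gluing S -> Estart l x -> y 0 = kappa ->
  ~ Estart l y -> close S x y n.+4.+1 ->
  n.+3 <= l /\ forall i, 0 < i < n.+3 -> y i = a.
Proof.
move=> gS [x0 xa xk xc] y0 nE cl.
have ex : exists d, x d != y d.
  case: (excluded_middle_informative (exists d, x d != y d)) => // nd; case: nE.
  have xy i : x i = y i.
    by apply/eqP/negPn/negP => d; apply: nd; exists i.
  by split; rewrite -?xy // => i il; rewrite -xy xa.
case: (ex_minnP ex) => d /eqP xyd dmin.
have ag : agree x y d.
  by move=> i id; apply/eqP/negPn/negP => /dmin; lia.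
have d0 : 0 < d by case: d xyd {dmin ag} => //; congruence.
have dl : d <= l.+2.
  case: leqP => // ld; case: nE; split=> //.
  - by move=> i il; rewrite -ag ?xa //; lia.
  - by rewrite -ag //; lia.
  - by rewrite -ag //; lia.
have dy : n.+3 <= d -> n.+3 <= l -> n.+3 <= l /\ forall i, 0 < i < n.+3 -> y i = a.
  by move=> nd nl; split=> // i il; rewrite -ag ?xa //; lia.
case: (leqP n.+4.+1 d) => [nd|dn]; first by apply: dy; lia.
have [p [q [Sp runs]]] := close_diff cl ag xyd dn.
case: (ltngtP d l.+1) => [dl'|dl'|dE].
- have xd : x d = a by apply: xa; lia.
  have ap : a <> p by rewrite -xd; apply: (glue_corner gS Sp).
  case: (ltngtP d l) => [dl2|dl2|dE]; first last.
  + case: (leqP n.+4.+1 d.+2) => dn2; first by apply: dy; lia.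
    have [xp _] := runs d.+1 ltac:(lia); have [xp' _] := runs d.+2 ltac:(lia).
    by move: xp xp'; rewrite dE xk xc; congruence.
  + by lia.
  + case: (leqP n.+4.+1 d.+1) => dn2; first by apply: dy; lia.
    have [xp _] := runs d.+1 ltac:(lia).
    by move: xp; rewrite xa; [congruence|lia].
- have dE : d = l.+2 by lia.
  by case: (glue_c gS Sp); rewrite dE.
- case: (leqP n.+4.+1 d.+1) => dn2; first by apply: dy; lia.
  have [xp _] := runs d.+1 ltac:(lia).
  case: (@glue_kappa _ gS (y d) q); move: Sp; rewrite -xp dE xk xc //.
Qed.

Variable R : L -> L -> L -> L -> Prop.
Hypothesis gR : gluing R.
Hypothesis R_fun : forall i p j q p' q', R i p j q -> R i p' j q' -> p = p' /\ q = q'.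
Hypothesis R_tau : R tau c kappa a.
(** This hypothesis and the next express gathering: apart from each other, the corner [c] of [tau]
    and the corner [a] of [kappa] are glued to the same corners. *)
Hypothesis R_tau_kappa :
  forall j q, R tau c j q -> j = kappa /\ q = a \/ R kappa a j q.
Hypothesis R_kappa_tau : forall j q, R kappa a j q -> j = tau \/ R tau c j q.

Definition unglue i p j q :=
  [/\ R i p j q, ~ (i = tau /\ p = c) & ~ (j = tau /\ q = c)].
Notation R' := unglue.

Lemma gluing_unglue : gluing R'.
Proof.
split.
- by move=> i p j q [/(glue_sym gR)].
- by move=> i p j q [/(glue_irr gR)].
- by move=> i p j q [/(glue_corner gR)].
- by move=> i p j q [/(glue_c gR)].
- by move=> j q [/(glue_kappa gR)].
Qed.
Notation gR' := gluing_unglue.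

(** * Pairs in which at least one word does not begin with a token *)

Lemma similar_close x x' y y' k : similar x x' -> similar y y' -> x 0 <> y 0 ->
  close R x y (k + 5) -> close R' x' y' k.
Proof.
move=> [x0 [xD _] _ xr _] [y0 [yD _] _ yr _] d0; rewrite addnC => cl.
have [p [q [Rp runs]]] := close_head cl d0.
apply: (@close_at0 _ R' x' y' k p q); rewrite -?x0 -?y0 //.
  (* A removed gluing would require the prefix [tau c c], which [plain] forbids. *)
  split=> //; move=> [zt zc]; [apply: xD|apply: yD]; split=> //.
  - by case: (runs 1 isT); congruence.
  - by case: (runs 2 isT); congruence.
  - by case: (runs 1 isT); congruence.
  - by case: (runs 2 isT); congruence.
by move=> i ik; split; [apply: (xr p k)|apply: (yr q k)]; try lia; move=> j jk;
  case: (runs j) => //; lia.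
Qed.

Lemma close_similar x x' y y' k : similar x x' -> similar y y' -> x 0 <> y 0 ->
  close R' x' y' (k + 5) -> close R x y k.
Proof.
move=> [x0 _ _ _ xr] [y0 _ _ _ yr] d0; rewrite addnC => cl.
have d0' : x' 0 <> y' 0 by rewrite -x0 -y0.
have [p [q [[Rp _ _] runs]]] := close_head cl d0'.
apply: (@close_at0 _ R x y k p q) => //; first by rewrite x0 y0.
by move=> i ik; split; [apply: (xr p k)|apply: (yr q k)]; try lia; move=> j jk;
  case: (runs j) => //; lia.
Qed.

Lemma D_similar_close m x x' y y' k :
  starts (D m) x -> starts (E m 0) x' -> similar y y' ->
  close R x y (k + 5) -> close R' x' y' k.
Proof.
move=> /starts_D[x0 xc xn] /starts_E[[x'0 x'a x'k x'c] _ _] [y0 [yD _] _ yr _].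
rewrite addnC => cl.
case: (eqVneq (y 0) tau) => [yt|/eqP yt].
  (* A plain word beginning with [tau] leaves the run of [c] at place 1 or 2, while [x] is still [c]
     there; closeness would stop too early. *)
  have [n [n2 ag yn]] : exists n, [/\ 0 < n <= 2, agree x y n & y n <> c].
    case: (eqVneq (y 1) c) => [y1|/eqP y1].
      exists 2; split=> // [[|[|i]] // _|y2]; first by congruence.
        by rewrite xc // y1.
      by apply: yD.
    by exists 1; split=> // [[|i] // _]; congruence.
  have xn2 : x n = c by apply: xc; lia.
  by have := close_c gR cl ag xn2 yn; lia.
have d0 : x 0 <> y 0 by congruence.
have [p [q [Rp runs]]] := close_head cl d0.
have pc : p = c by case: (runs 1 isT) => <- _; apply: xc.
rewrite x0 {}pc in Rp runs.
have mk : k.+2 <= m.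
  case: leqP => // mk; case: xn; case: (runs m.+3) => //; lia.
have yq i : 0 < i < k.+3 -> y i = q by move=> ik; case: (runs i) => //; lia.
have y'q i : 0 < i <= k -> y' i = q by apply: yr yq i.
(* Either [y] follows [kappa a a ...], as [x'] does, or its first letter is also glued to the corner
   [a] of [kappa]. *)
case: (R_tau_kappa Rp) => [[yk qa]|Rk].
  left=> -[|i] ik; first by congruence.
  by rewrite y'q ?x'a ?qa //; lia.
apply: (@close_at0 _ _ _ _ _ a q); rewrite -?y0 ?x'0.
- exact: (glue_irr gR Rk).
- by split=> //; case; congruence.
- by move=> i ik; split; [apply: x'a; lia|apply: y'q; lia].
Qed.

Lemma close_D_similar m x x' y y' k :
  starts (D m) x -> starts (E m 0) x' -> similar y y' ->
  close R' x' y' (k + 5) -> close R x y k.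
Proof.
move=> /starts_D[x0 xc xn] /starts_E[ex' _ _].
have [x'0 x'a x'k x'c] := ex'.
move=> [y0 _ [_ y'E] _ yr]; rewrite addnC => cl.
case: (eqVneq (y 0) kappa) => [yk|/eqP yk].
  have y'k : y' 0 = kappa by congruence.
  (* Here both images follow [kappa a a ...], and the gluing [R_tau] makes the originals close. *)
  have [km y'a] := Estart_close gR' ex' y'k (y'E m) cl.
  apply: (@close_at0 _ R x y k c a); rewrite ?x0 ?yk //.
  by move=> i ik; split; [apply: xc|apply: (yr a k y'a)]; lia.
have d0 : x' 0 <> y' 0 by congruence.
have [p [q [[Rp _ Rt] runs]]] := close_head cl d0.
have kp := glue_corner gR Rp; rewrite x'0 -?y0 in Rp kp Rt.
(* For [m = 0] the image begins with [kappa kappa], so the run would go to the corner [kappa] of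
   [kappa] itself, against [glue_corner]. *)
case: m xc xn ex' x'a x'k x'c {y'E} => [|m] xc xn ex' x'a x'k x'c.
  by case: (runs 1 isT); congruence.
have pa : p = a by case: (runs 1 isT) => <- _; apply: x'a.
rewrite {}pa in Rp runs {kp}.
have mk : k.+3 <= m.
  case: leqP => // mk.
  have [xp _] := runs m.+2 ltac:(lia).
  by congruence.
case: (R_kappa_tau Rp) => [yt|Rq].
  (* By [R_fun] this would be the gluing at the corner [c] of [tau], which [R'] lacks. *)
  case: Rt; split=> //.
  by rewrite yt in Rp; case: (R_fun Rp (glue_sym gR R_tau)).
apply: (@close_at0 _ R x y k c q); rewrite ?x0 //; first exact: (glue_irr gR Rq).
move=> i ik; split; [apply: xc; lia|apply: (yr q k); last lia].
by move=> j jk; case: (runs j) => //; lia.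
Qed.

(** Closeness forces a long run of [a] in the token. Then [phi] only shortens this run by one
    letter, so the gluing at the corner [a] of [kappa] persists. *)
Lemma E_similar_close l m x x' y y' k :
  starts (E l m) x -> starts (phi (E l m)) x' -> similar y y' ->
  close R x y (k + 5) -> close R' x' y' k.
Proof.
move=> /starts_E[ex _ _] sx' [y0 [yD yE] _ yr _]; rewrite addnC => cl.
have [x0 xa xk xc] := ex.
case: (eqVneq (y 0) kappa) => [yk|/eqP yk].
  have [kl ya] := Estart_close gR ex yk (yE l) cl.
  case: l ex sx' xa xk xc yE kl => // l ex /starts_E[[x'0 x'a _ _] _ _] _ _ _ _ kl.
  left=> -[|i] ik; first by congruence.
  by rewrite x'a ?(yr a k) //; lia.
have d0 : x 0 <> y 0 by congruence.
have [p [q [Rp runs]]] := close_head cl d0.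
have kp := glue_corner gR Rp; rewrite x0 in Rp kp.
case: l ex sx' xa xk xc {yE} => [|l] ex sx' xa xk xc.
  by case: (runs 1 isT); congruence.
have [[x'0 x'a _ _] _ _] := starts_E sx'.
have pa : p = a by case: (runs 1 isT) => <- _; apply: xa.
rewrite {}pa in Rp runs {kp}.
have lk : k.+2 <= l.
  case: leqP => // lk.
  have [xp _] := runs l.+2 ltac:(lia).
  by congruence.
apply: (@close_at0 _ R' x' y' k a q); rewrite ?x'0 -?y0 //; first by congruence.
  split=> //; first by case; congruence.
  move=> [yt qc]; apply: yD; split=> //.
    by case: (runs 1 isT); congruence.
  by case: (runs 2 isT); congruence.
move=> i ik; split; [apply: x'a; lia|apply: (yr q k); last lia].
by move=> j jk; case: (runs j) => //; lia.
Qed.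

(** For [l = 0] the image begins with [tau c c]: no gluing of [R'] continues it, and a plain word
    leaves it early. For larger [l] both tokens begin with [kappa] and a run of [a]. *)
Lemma close_E_similar l m x x' y y' k :
  starts (E l m) x -> starts (phi (E l m)) x' -> similar y y' ->
  close R' x' y' (k + 5) -> close R x y k.
Proof.
move=> /starts_E[ex _ _] sx' [y0 [yD yE] [y'D y'E] _ yr]; rewrite addnC => cl.
have [x0 xa xk xc] := ex.
case: l ex sx' xa xk xc {yE} => [|l] ex sx' xa xk xc.
  have [x'0 x'c _] := starts_D sx'.
  case: (eqVneq (y' 0) tau) => [yt|/eqP yt].
    have [n [n2 ag yn]] : exists n, [/\ 0 < n <= 2, agree x' y' n & y' n <> c].
      case: (eqVneq (y' 1) c) => [y1|/eqP y1].
        exists 2; split=> // [[|[|i]] // _|y2]; first by congruence.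
          by rewrite x'c // y1.
        by apply: y'D.
      by exists 1; split=> // [[|i] // _]; congruence.
    have xn2 : x' n = c by apply: x'c; lia.
    by have := close_c gR' cl ag xn2 yn; lia.
  have d0 : x' 0 <> y' 0 by congruence.
  have [p [q [[Rp nt _] runs]]] := close_head cl d0.
  case: nt; split=> //.
  by case: (runs 1 isT) => <- _; apply: x'c.
have [ex' _ _] := starts_E sx'.
have [x'0 x'a x'k x'c] := ex'.
case: (eqVneq (y' 0) kappa) => [yk|/eqP yk].
  have [kl y'a] := Estart_close gR' ex' yk (y'E l) cl.
  left=> -[|i] ik; first by congruence.
  by rewrite xa ?(yr a k) //; lia.
have d0 : x' 0 <> y' 0 by congruence.
have [p [q [[Rp _ _] runs]]] := close_head cl d0.
have kp := glue_corner gR Rp; rewrite x'0 in Rp kp.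
case: l ex' x'a x'k x'c {y'E sx'} ex xa xk xc => [|l] ex' x'a x'k x'c ex xa xk xc.
  by case: (runs 1 isT); congruence.
have pa : p = a by case: (runs 1 isT) => <- _; apply: x'a.
rewrite {}pa in Rp runs {kp}.
have lk : k.+2 <= l.
  case: leqP => // lk.
  have [xp _] := runs l.+2 ltac:(lia).
  by congruence.
apply: (@close_at0 _ R x y k a q); rewrite ?x0 ?y0 //; first by congruence.
move=> i ik; split; [apply: xa; lia|apply: (yr q k); last lia].
by move=> j jk; case: (runs j) => //; lia.
Qed.

(** * Pairs of words that begin with different tokens *)

Lemma Estart_agree l l' x y n :
  Estart l x -> Estart l' y -> n <= l.+1 -> n <= l'.+1 -> agree x y n.
Proof.
move=> [x0 xa _ _] [y0 ya _ _] nl nl' [|i] ni; first by congruence.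
by rewrite xa ?ya //; lia.
Qed.

Lemma starts_agree_D m m' x y :
  starts (D m) x -> starts (D m') y -> m < m' ->
  [/\ agree x y m.+3, x m.+3 <> c & y m.+3 = c].
Proof.
move=> /starts_D[x0 xc xn] /starts_D[y0 yc _] mm; split=> //; last by apply: yc; lia.
by case=> [|i] im; [congruence|rewrite xc ?yc //; lia].
Qed.

Lemma starts_agree_E l m m' x y :
  starts (E l m) x -> starts (E l m') y -> m < m' ->
  [/\ agree x y (l + m).+3, x (l + m).+3 <> c & y (l + m).+3 = c].
Proof.
move=> /starts_E[ex xc xn] /starts_E[ey yc _] mm; split=> //; last by apply: yc; lia.
move=> i im; case: (leqP i l) => il; first by apply: (@Estart_agree _ _ _ _ i.+1 ex ey); lia.
case: (eqVneq i l.+1) => [->|/eqP il1].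
  by case: ex ey => [_ _ -> _] [_ _ -> _].
by rewrite xc ?yc //; lia.
Qed.

(** The shorter run of [c] bounds closeness by [m], and the images share the prefix [kappa a^m]. *)
Lemma DD_close m m' x x' y y' k : m < m' ->
  starts (D m) x -> starts (E m 0) x' -> starts (D m') y -> starts (E m' 0) y' ->
  close R x y (k + 5) -> close R' x' y' k.
Proof.
move=> mm sx /starts_E[ex' _ _] sy /starts_E[ey' _ _] /(close_sym (glue_sym gR)) cl.
have [ag xn yn] := starts_agree_D sx sy mm.
have ag' : agree y x m.+3 by move=> i /ag.
have km := close_c gR cl ag' yn xn.
by apply: (@agree_close _ _ _ _ m.+1); [apply: Estart_agree ex' ey' _ _|]; lia.
Qed.

Lemma close_DD m m' x x' y y' k : m < m' ->
  starts (D m) x -> starts (E m 0) x' -> starts (D m') y -> starts (E m' 0) y' ->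
  close R' x' y' (k + 5) -> close R x y k.
Proof.
move=> mm sx /starts_E[ex' _ _] sy /starts_E[ey' _ _]; rewrite addnC => cl.
have nE : ~ Estart m y' by move/(Estart_inj ey'); lia.
have [y'0 _ _ _] := ey'.
have [km _] := Estart_close gR' ex' y'0 nE cl.
have [ag _ _] := starts_agree_D sx sy mm.
by apply: agree_close ag _; lia.
Qed.

(** By [R_fun] the gluing in use is [R_tau], so the runs of [c] and of [a] are both long. The images
    then both begin with [kappa] and a long run of [a]. *)
Lemma DE_close m l m' x x' y y' k :
  starts (D m) x -> starts (E m 0) x' ->
  starts (E l m') y -> starts (phi (E l m')) y' ->
  close R x y (k + 5) -> close R' x' y' k.
Proof.
move=> /starts_D[x0 xc xn] /starts_E[ex' _ _] /starts_E[[y0 ya yk yc] _ _] sy'.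
rewrite addnC => cl.
have d0 : x 0 <> y 0 by congruence.
have [p [q [Rp runs]]] := close_head cl d0.
have pc : p = c by case: (runs 1 isT) => <- _; apply: xc.
rewrite x0 y0 pc in Rp.
have [_ qa] := R_fun Rp R_tau.
case: (leqP k.+1 m) => km; last first.
  by case: xn; rewrite -pc; case: (runs m.+3) => //; lia.
case: (leqP k.+3 l) => kl; last first.
  by case: (runs l.+1) => [|_]; [lia|congruence].
case: l sy' ya yk yc kl => // l /starts_E[ey' _ _] _ _ _ kl.
by apply: (@agree_close _ _ _ _ k) => //; apply: Estart_agree ex' ey' _ _; lia.
Qed.

Lemma close_DE m l m' x x' y y' k :
  starts (D m) x -> starts (E m 0) x' ->
  starts (E l m') y -> starts (phi (E l m')) y' ->
  close R' x' y' (k + 5) -> close R x y k.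
Proof.
move=> /starts_D[x0 xc xn] sx' /starts_E[[y0 ya yk yc] _ _] sy' cl.
have close_R : k <= m.+3 -> k <= l.+1 -> close R x y k.
  move=> km kl; apply: (@close_at0 _ R x y k c a); rewrite ?x0 ?y0 //.
  by move=> i ik; split; [apply: xc|apply: ya]; lia.
have [ex' _ _] := starts_E sx'.
have [x'0 x'a x'k x'c] := ex'.
case: l sy' ya yk yc close_R => [|l] sy' ya yk yc close_R.
  have [y'0 y'c _] := starts_D sy'.
  have d0 : x' 0 <> y' 0 by congruence.
  rewrite addnC in cl; have [p [q [[Rp _ nt] runs]]] := close_head cl d0.
  by case: nt; split=> //; case: (runs 1 isT) => _ <-; apply: y'c.
have [ey' _ _] := starts_E sy'.
have [y'0 _ _ _] := ey'.
(* If [l = m], the images differ only in the final runs of [c], of lengths 1 and [m'.+2], so they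
   separate at a letter [c]. *)
case: (eqVneq l m) => [lm|/eqP lm].
  rewrite lm in sy'.
  have [ag xn' yn'] := starts_agree_E sx' sy' isT.
  have ag' : agree y' x' (m + 0).+3 by move=> i /ag.
  have := close_c gR' (close_sym (glue_sym gR') cl) ag' yn' xn'.
  by move=> km; apply: close_R; lia.
have nE : ~ Estart m y' by move/(Estart_inj ey').
have nE' : ~ Estart l x' by move/(Estart_inj ex')=> /esym.
rewrite addnC in cl.
have [km _] := Estart_close gR' ex' y'0 nE cl.
have [kl _] := Estart_close gR' ey' x'0 nE' (close_sym (glue_sym gR') cl).
by apply: close_R; lia.
Qed.

(** Different runs of [a] are compared by [Estart_close], equal ones through the final runs of [c].
    In both cases the images agree as far as needed. *)
Lemma EE_close l m l' m' x x' y y' k : l < l' \/ l = l' /\ m < m' ->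
  starts (E l m) x -> starts (phi (E l m)) x' ->
  starts (E l' m') y -> starts (phi (E l' m')) y' ->
  close R x y (k + 5) -> close R' x' y' k.
Proof.
move=> [ll|[<- mm]] sx sx' sy sy' cl.
  have [ex _ _] := starts_E sx; have [ey _ _] := starts_E sy.
  have nE : ~ Estart l y by move/(Estart_inj ey); lia.
  have [y0 _ _ _] := ey; rewrite addnC in cl.
  have [kl _] := Estart_close gR ex y0 nE cl.
  case: l l' sx' sy' kl ll {sx sy ex ey nE} => [|l] [|l'] // sx' sy' kl ll.
  have [ex' _ _] := starts_E sx'; have [ey' _ _] := starts_E sy'.
  by apply: (@agree_close _ _ _ _ k) => //; apply: Estart_agree ex' ey' _ _; lia.
have [ag xn yn] := starts_agree_E sx sy mm.
have ag' : agree y x (l + m).+3 by move=> i /ag.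
have km := close_c gR (close_sym (glue_sym gR) cl) ag' yn xn.
case: l sx' sy' km {sx sy ag xn yn ag' cl} => [|l] sx' sy' km.
  by have [ag _ _] := starts_agree_D sx' sy' mm; apply: agree_close ag _; lia.
by have [ag _ _] := starts_agree_E sx' sy' mm; apply: agree_close ag _; lia.
Qed.

Lemma close_EE l m l' m' x x' y y' k : l < l' \/ l = l' /\ m < m' ->
  starts (E l m) x -> starts (phi (E l m)) x' ->
  starts (E l' m') y -> starts (phi (E l' m')) y' ->
  close R' x' y' (k + 5) -> close R x y k.
Proof.
move=> [ll|[<- mm]] sx sx' sy sy' cl.
  have [ex _ _] := starts_E sx; have [ey _ _] := starts_E sy.
  case: l' sy' ll {sy} ey => // l' sy' ll ey.
  have [ey' _ _] := starts_E sy'; have [y'0 y'a _ _] := ey'.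
  rewrite addnC in cl.
  case: l sx' ll {sx} ex => [|l] sx' ll ex.
    have [x'0 x'c _] := starts_D sx'.
    have d0 : x' 0 <> y' 0 by congruence.
    have [p [q [[Rp nt _] runs]]] := close_head cl d0.
    by case: nt; split=> //; case: (runs 1 isT) => <- _; apply: x'c.
  have [ex' _ _] := starts_E sx'.
  have nE : ~ Estart l y' by move/(Estart_inj ey'); lia.
  have [kl _] := Estart_close gR' ex' y'0 nE cl.
  by apply: (@agree_close _ _ _ _ k) => //; apply: Estart_agree ex ey _ _; lia.
have [ag _ _] := starts_agree_E sx sy mm.
apply: agree_close ag _.
have cl' := close_sym (glue_sym gR') cl.
case: l sx' sy' {sx sy cl} => [|l] sx' sy'.
  have [ag' xn yn] := starts_agree_D sx' sy' mm.
  have ag2 : agree y' x' m.+3 by move=> i /ag'.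
  by have := close_c gR' cl' ag2 yn xn; lia.
have [ag' xn yn] := starts_agree_E sx' sy' mm.
have ag2 : agree y' x' (l + m.+1).+3 by move=> i /ag'.
by have := close_c gR' cl' ag2 yn xn; lia.
Qed.

(** * Removal of equal initial blocks and the two distortion bounds *)

Lemma token_cases s s' : s = s' \/
  [\/ exists m m', m < m' /\ (s = D m /\ s' = D m' \/ s' = D m /\ s = D m'),
      exists m l m', s = D m /\ s' = E l m' \/ s' = D m /\ s = E l m' |
      exists l m l' m', (l < l' \/ l = l' /\ m < m') /\
        (s = E l m /\ s' = E l' m' \/ s' = E l m /\ s = E l' m')].
Proof.
case: s s' => [m|l m] [m'|l' m'].
- case: (ltngtP m m') => [lt|gt|->]; [|by right; constructor 1; exists m', m; tauto|by left].
  by right; constructor 1; exists m, m'; tauto.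
- by right; constructor 2; exists m, l', m'; tauto.
- by right; constructor 2; exists m', l, m; tauto.
- case: (ltngtP l l') => [lt|gt|->].
  + by right; constructor 3; exists l, m, l', m'; tauto.
  + by right; constructor 3; exists l', m', l, m; tauto.
  case: (ltngtP m m') => [lt|gt|->]; last by left.
  + by right; constructor 3; exists l', m, l', m'; tauto.
  + by right; constructor 3; exists l', m', l', m; tauto.
Qed.

Notation g := rearr.

Lemma close_rearr_shift S n x y K : agree (g x) (g y) n ->
  (forall z, z = x \/ z = y -> forall i, g z (n + i) = g (shift n z) i) ->
  close S (g x) (g y) (n + K) <-> close S (g (shift n x)) (g (shift n y)) K.
Proof.
move=> ag gs; rewrite close_shift //.
by split; apply: eq_close => i; rewrite /shift gs //; [left|right|left|right].
Qed.

Lemma token_eq_dec (s s' : token) : {s = s'} + {s <> s'}.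
Proof. by decide equality; apply: PeanoNat.Nat.eq_dec. Qed.

(* [P k x y] stands for either implication of the distortion bound. *)
Lemma peel_induction (P : nat -> (nat -> L) -> (nat -> L) -> Prop) :
  (forall k x y, P k x y -> P k y x) ->
  (forall n k x y, agree x y n -> agree (g x) (g y) n ->
     (forall z, z = x \/ z = y -> forall i, g z (n + i) = g (shift n z) i) ->
     (forall k', k = n + k' -> P k' (shift n x) (shift n y)) -> P k x y) ->
  (forall k x y, similar x (g x) -> similar y (g y) -> x 0 <> y 0 -> P k x y) ->
  (forall s k x y, starts s x -> starts (phi s) (g x) -> similar y (g y) -> P k x y) ->
  (forall s s' k x y, s <> s' -> starts s x -> starts (phi s) (g x) ->
     starts s' y -> starts (phi s') (g y) -> P k x y) ->
  forall k x y, escapes x -> escapes y -> P k x y.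
Proof.
(* Strong induction on [k]: a common token or a common first letter has positive length and is
   removed from the words and their images alike. *)
move=> Psym Ppeel Pss Pts Ptt k; have [b] := ubnP k; elim: b k => // b IH k kb x y ex ey.
case tx: (token_at x) => [s|]; case ty: (token_at y) => [s'|].
- have sx := token_atS tx; have sy := token_atS ty.
  have sx' := rearr_starts tx; have sy' := rearr_starts ty.
  case: (token_eq_dec s s') => [ss|ss]; last exact: Ptt ss sx sx' sy sy'.
  subst s'; apply: (Ppeel (len s)).
  + by move=> i il; rewrite (proj1 sx) ?(proj1 sy).
  + by move=> i il; rewrite !(@rearr_token s).
  + by move=> z [] -> i; apply: rearr_token_shift.
  + move=> k' kk; apply: IH; try exact: escapes_shift.
    by move: kk kb; case: s {tx ty sx sy sx' sy'} => [m|l m] /=; lia.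
- exact: Pts (token_atS tx) (rearr_starts tx) (rearr_similar ey ty).
- exact/Psym/(Pts _ _ _ _ (token_atS ty) (rearr_starts ty) (rearr_similar ex tx)).
- case: (eqVneq (x 0) (y 0)) => [xy|/eqP xy].
    apply: (Ppeel 1).
    + by case.
    + by case=> // _; rewrite !rearr_head.
    + by move=> z [] -> i; apply: rearr_tail.
    + by move=> k' kk; apply: IH; try exact: escapes_shift; lia.
  by apply: Pss => //; apply: rearr_similar.
Qed.

Lemma rearr_close k x y : escapes x -> escapes y ->
  close R x y (k + 5) -> close R' (g x) (g y) k.
Proof.
move: k x y; apply: peel_induction.
- by move=> k x y H /(close_sym (glue_sym gR))/H/(close_sym (glue_sym gR')).
- move=> n k x y ag ag' gs IH cl.
  case: (leqP k n) => kn; first exact: agree_close ag' kn.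
  rewrite -(subnKC (ltnW kn)) in cl *.
  apply/(close_rearr_shift _ _ ag' gs)/IH; first by lia.
  by apply/(close_shift _ _ ag); rewrite addnA.
- by move=> k x y; apply: similar_close.
- by move=> [m|l m] k x y; [apply: D_similar_close|apply: E_similar_close].
- move=> s s' k x y ss sx sx' sy sy' cl.
  have cl' := close_sym (glue_sym gR) cl.
  case: (token_cases s s') => // [] [].
  + move=> [m [m' [mm [[]|[]]]]] ? ?; subst; first exact: DD_close mm sx sx' sy sy' cl.
    exact: (close_sym (glue_sym gR') (DD_close mm sy sy' sx sx' cl')).
  + move=> [m [l [m' [[]|[]]]]] ? ?; subst; first exact: DE_close sx sx' sy sy' cl.
    exact: (close_sym (glue_sym gR') (DE_close sy sy' sx sx' cl')).
  + move=> [l [m [l' [m' [mm [[]|[]]]]]]] ? ?; subst;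
    first exact: EE_close mm sx sx' sy sy' cl.
    exact: (close_sym (glue_sym gR') (EE_close mm sy sy' sx sx' cl')).
Qed.

Lemma close_rearr k x y : escapes x -> escapes y ->
  close R' (g x) (g y) (k + 5) -> close R x y k.
Proof.
move: k x y; apply: peel_induction.
- by move=> k x y H /(close_sym (glue_sym gR'))/H/(close_sym (glue_sym gR)).
- move=> n k x y ag ag' gs IH cl.
  case: (leqP k n) => kn; first exact: agree_close ag kn.
  rewrite -(subnKC (ltnW kn)) in cl *.
  apply/(close_shift _ _ ag)/IH; first by lia.
  by apply/(close_rearr_shift _ _ ag' gs); rewrite addnA.
- by move=> k x y; apply: close_similar.
- by move=> [m|l m] k x y; [apply: close_D_similar|apply: close_E_similar].
- move=> s s' k x y ss sx sx' sy sy' cl.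
  have cl' := close_sym (glue_sym gR') cl.
  case: (token_cases s s') => // [] [].
  + move=> [m [m' [mm [[]|[]]]]] ? ?; subst; first exact: close_DD mm sx sx' sy sy' cl.
    exact: (close_sym (glue_sym gR) (close_DD mm sy sy' sx sx' cl')).
  + move=> [m [l [m' [[]|[]]]]] ? ?; subst; first exact: close_DE sx sx' sy sy' cl.
    exact: (close_sym (glue_sym gR) (close_DE sy sy' sx sx' cl')).
  + move=> [l [m [l' [m' [mm [[]|[]]]]]]] ? ?; subst;
    first exact: close_EE mm sx sx' sy sy' cl.
    exact: (close_sym (glue_sym gR) (close_EE mm sy sy' sx sx' cl')).
Qed.

Lemma rearr_eventually n x : (forall i, n <= i -> x i = kappa) ->
  forall i, n <= i -> g x i = kappa.
Proof.
move=> xk i; have [b] := ubnP i; elim: b n x i xk => // b IH n x i xk ib ni.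
case tx: (token_at x) => [s|].
  have [st nc] := token_atS tx.
  (* Every token ends with [c <> kappa], so it cannot reach into the constant tail. *)
  have sn : len s <= n.
    case: leqP => // ns; have := st (len s).-1; rewrite xk; last by lia.
    by case: s {tx st nc ns} => [m|l m] /= H; have := H ltac:(lia);
      repeat (case: ifP => //); congruence || lia.
  have s0 : 0 < len s by case: (s).
  rewrite -(subnKC (leq_trans sn ni)) (rearr_token_shift _ tx).
  by apply: (IH (n - len s)); [move=> j nj; apply: xk|..]; lia.
case: i ib ni => [|i] ib ni; first by rewrite rearr_head // xk.
rewrite rearr_tail //.
by apply: (IH n.-1); [move=> j nj; apply: xk; rewrite add1n|..]; lia.
Qed.

End Rearrangement.

(** * From triangle automata to gluings *)

Definition le_opt k (t : option nat) : bool := if t is Some m then k <= m else true.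

Section Automaton.
Variables (N : nat) (M : triangle N).
Implicit Types (x y : word N).

(** The indices cross over: the state [St u v] persists on reading the letters at [v] and [u], so
    the first word runs to the letter at [v] and the second to the letter at [u]. *)
Definition corner_gluing (i p j q : 'I_N) : Prop :=
  exists u v, [/\ P M u v i j, pos M v = inl p & pos M u = inl q].

Hypothesis P_fun :
  forall u v u' v' i j, P M u v i j -> P M u' v' i j -> u = u' /\ v = v'.
Hypothesis pos_letter : forall u, exists p, pos M u = inl p.

Lemma run_agree x y k : agree x y k -> run M x y k = Id.
Proof.
elim: k => //= k IH ag; rewrite IH => [|i ik]; last by apply: ag; lia.
by rewrite /= ag ?eqxx.
Qed.

Lemma run_inv x y k :
  match run M x y k with
  | Id => agree x y k
  | Exit => True
  | St u v => exists n, [/\ n < k, agree x y n, x n <> y n, P M u v (x n) (y n) &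
      forall i, n < i < k -> pos M v = inl (x i) /\ pos M u = inl (y i)]
  end.
Proof.
elim: k => [|k] //=; case: (run M x y k) => [ag||u v [n [nk ag d Puv runs]]] //=.
  case: eqP => [xy i|d].
    by rewrite ltnS leq_eqVlt => /orP[/eqP->|/ag].
  case: pickP => // -[u v] /= Puv; exists k; split=> // i; lia.
case: ifP => // /andP[/eqP pv /eqP pu]; exists n; split=> //; first by lia.
move=> i /andP[ni]; rewrite ltnS leq_eqVlt => /orP[/eqP->|ik] //.
by apply: runs; rewrite ni.
Qed.

(** The bridge between automaton and gluings. The converse direction uses that a letter pair
    determines its state, so that [pick] returns the expected one. *)
Lemma run_close x y k :
  ~~ is_exit (run M x y k) <-> close corner_gluing x y k.
Proof.
split=> [|[ag|[n [p [q [nk ag d [u [v [Puv pv pu]]] runs]]]]]].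
- have := run_inv x y k; case: (run M x y k) => //; first by left.
  move=> u v [n [nk ag d Puv runs]] _.
  have [p pv] := pos_letter v; have [q pu] := pos_letter u.
  right; exists n, p, q; split=> //; first by exists u, v.
  by move=> i /runs[]; rewrite pv pu => -[->] [->].
- by rewrite run_agree.
- suff -> : run M x y k = St u v by [].
  elim: k nk runs => // k IH; rewrite ltnS leq_eqVlt => /orP[/eqP<-|nk] runs /=.
    rewrite run_agree //=; case: eqP => // _.
    case: pickP => [[u' v'] /= Puv'|/(_ (u, v))]; last by rewrite /= Puv.
    by have [-> ->] := P_fun Puv' Puv.
  rewrite IH // => [|i ik]; last by apply: runs; lia.
  by have [-> ->] := runs k ltac:(lia); rewrite /= pv pu !eqxx.
Qed.

Lemma exit_le x y m n : m <= n -> is_exit (run M x y m) -> is_exit (run M x y n).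
Proof.
move=> mn; rewrite -(subnKC mn); elim: (n - m) => [|d IH] ex; rewrite ?addn0 //.
by rewrite addnS /=; move: (IH ex); case: (run M x y (m + d)).
Qed.

Lemma T_ge x y k :
  ~~ is_exit (run M x y k) <-> le_opt k (T M x y).
Proof.
rewrite /T /le_opt; case: excluded_middle_informative => [ex|nex].
  case: (ex_minnP ex) => m exm minm; split=> [nek|km].
    by rewrite leqNgt; apply: contra nek => mk; apply: exit_le exm.
  by case: k km => // k km; apply/negP => /minm; lia.
split=> // _; case: k => // k; apply/negP => exk; by apply: nex; exists k.
Qed.

End Automaton.

(** The bounds come from taking [k] to be a finite value minus [d]; taking [k] one above a finite
    value shows that both values are infinite together. *)
Lemma dist_le_T N (M M' : triangle N) x y x' y' d :
  (forall k, ~~ is_exit (run M x y (k + d)) -> ~~ is_exit (run M' x' y' k)) ->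
  (forall k, ~~ is_exit (run M' x' y' (k + d)) -> ~~ is_exit (run M x y k)) ->
  dist_le (T M x y) (T M' x' y') d.
Proof.
move=> H H'.
have {}H k : le_opt (k + d) (T M x y) -> le_opt k (T M' x' y')
  by move=> h; apply/T_ge/H/T_ge.
have {}H' k : le_opt (k + d) (T M' x' y') -> le_opt k (T M x y)
  by move=> h; apply/T_ge/H'/T_ge.
case: (T M x y) H H' => [m|]; case: (T M' x' y') => [n|] //; rewrite /le_opt /= => H H'.
- case: (leqP m d) => md; case: (leqP n d) => nd.
  + by lia.
  + by have := H' (n - d); lia.
  + by have := H (m - d); lia.
  + by have := H (m - d); have := H' (n - d); lia.
- by have := H' m.+1 isT; lia.
- by have := H n.+1 isT; lia.
Qed.

(** * The bijection on words ending in [kappa], for either position of the removed pair *)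

Section Omega.
Variables (N : nat) (M M' : triangle N) (tau kappa : 'I_N).
(** [g] is the index of gamma, [e] that of alpha or beta, whichever is related to gamma by the pair
    [(tau, kappa)], and [e'] is the remaining one. One argument thus covers both cases. *)
Variables (e e' g : 'I_3) (a b c : 'I_N).
Hypotheses (pos_e : pos M e = inl a) (pos_e' : pos M e' = inl b)
  (pos_g : pos M g = inl c).
Hypothesis eg : forall u, [\/ u = e, u = e' | u = g].
Hypotheses (ab : a <> b) (ac : a <> c) (bc : b <> c).
Hypothesis P_sym : forall u v i j, P M u v i j -> P M v u j i.
Hypothesis P_diag : forall u i j, ~ P M u u i j.
Hypothesis P_irr : forall u v i, ~ P M u v i i.
Hypothesis P_fun :
  forall u v u' v' i j, P M u v i j -> P M u' v' i j -> u = u' /\ v = v'.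
Hypothesis P_uniq : forall u v i j j', P M u v i j -> P M u v i j' -> j = j'.
Hypothesis P_corner : forall u v i j, P M u v i j -> pos M v <> inl i.
Hypothesis P_c : forall u v j, ~ P M u v c j.
Hypothesis P_kappa : forall u j, ~ P M u g kappa j.
Hypothesis P_tau : P M e g tau kappa.
Hypothesis gathering1 : forall i j l, P M e g i j -> P M e' g i l -> P M e' e j l.
Hypothesis gathering2 : forall i j l, P M e g i j -> P M e' e j l -> P M e' g i l.
Hypothesis pos' : forall u, pos M' u = pos M u.
Hypothesis P'E : forall u v i j, P M' u v i j <->
  [/\ P M u v i j, ~ (i = tau /\ v = g) & ~ (j = tau /\ u = g)].

Lemma pos_cases u p : pos M u = inl p ->
  [\/ u = e /\ p = a, u = e' /\ p = b | u = g /\ p = c].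
Proof.
by case: (eg u) => -> /[dup]; rewrite ?{1}pos_e ?{1}pos_e' ?{1}pos_g => -[->];
  [constructor 1|constructor 2|constructor 3].
Qed.

Lemma pos_inj u v p : pos M u = inl p -> pos M v = inl p -> u = v.
Proof.
by move=> /pos_cases[[-> ->]|[-> ->]|[-> ->]] /pos_cases[[-> ?]|[-> ?]|[-> ?]] //; congruence.
Qed.

Lemma pos_has_letter u : exists p, pos M u = inl p.
Proof. by case: (eg u) => ->; [exists a|exists b|exists c]. Qed.

Notation R := (corner_gluing M).

Lemma gluing_M : gluing kappa c R.
Proof.
split.
- by move=> i p j q [u [v [/P_sym Puv pv pu]]]; exists v, u.
- by move=> i p j q [u [v [Puv _ _]]] ij;
    apply: (P_irr (u := u) (v := v) (i := i)); rewrite {2}ij.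
- by move=> i p j q [u [v [Puv pv _]]] ip; apply: (P_corner Puv); rewrite pv ip.
- by move=> i p j q [u [v [Puv _ _]]] ic; apply: (@P_c u v j); rewrite -ic.
- move=> j q [u [v [Puv pv _]]]; have vg := pos_inj pv pos_g; subst v.
  exact: P_kappa Puv.
Qed.

Lemma gluing_fun i p j q p' q' : R i p j q -> R i p' j q' -> p = p' /\ q = q'.
Proof.
move=> [u [v [Puv pv pu]]] [u' [v' [Puv' pv' pu']]].
have [uu vv] := P_fun Puv Puv'; subst u' v'.
by move: pv' pu'; rewrite pv pu => -[->] [->].
Qed.

Lemma gluing_tau : R tau c kappa a.
Proof. by exists e, g. Qed.

Lemma gluing_tau_kappa j q : R tau c j q -> j = kappa /\ q = a \/ R kappa a j q.
Proof.
move=> [u [v [Puv pv pu]]]; have vg := pos_inj pv pos_g; subst v.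
case: (eg u) => ug; subst u.
- left; split; first exact: P_uniq Puv P_tau.
  by move: pu; rewrite pos_e => -[].
- by right; exists e', e; split=> //; apply: gathering1 Puv.
- by case: (P_diag Puv).
Qed.

Lemma gluing_kappa_tau j q : R kappa a j q -> j = tau \/ R tau c j q.
Proof.
move=> [u [v [Puv pv pu]]]; have ve := pos_inj pv pos_e; subst v.
case: (eg u) => ug; subst u.
- by case: (P_diag Puv).
- by right; exists e', g; split=> //; apply: gathering2 Puv.
- left; exact: P_uniq Puv (P_sym P_tau).
Qed.

Lemma corner_gluing_M' i p j q :
  corner_gluing M' i p j q <-> unglue tau c R i p j q.
Proof.
split.
  move=> [u [v [/P'E[Puv nv nu]]]]; rewrite !pos' => pv pu.
  split; first by exists u, v.
    by move=> [it pc]; apply: nv; split=> //; apply: (pos_inj pv); rewrite pc.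
  by move=> [jt qc]; apply: nu; split=> //; apply: (pos_inj pu); rewrite qc.
move=> [[u [v [Puv pv pu]]] nv nu]; exists u, v; rewrite !pos'; split=> //.
apply/P'E; split=> // -[it ug]; [apply: nv|apply: nu]; split=> //.
  by move: pv; rewrite ug pos_g => -[].
by move: pu; rewrite ug pos_g => -[].
Qed.

Lemma kappa_neq : [/\ a <> kappa, tau <> kappa, c <> a, c <> kappa & c <> tau].
Proof.
split.
- by move=> ak; apply: (P_corner (P_sym P_tau)); rewrite pos_e ak.
- by move=> tk; apply: (P_irr (u := e) (v := g) (i := tau)); rewrite {2}tk.
- by move=> /esym.
- by move=> ck; apply: (P_c (u := g) (v := e) (j := tau)); rewrite ck; apply: P_sym.
- by move=> ct; apply: (P_c (u := e) (v := g) (j := kappa)); rewrite ct.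
Qed.

Notation f := (rearr tau kappa a c).

Lemma omega_escapes x : in_Omega kappa x -> escapes c x.
Proof.
move=> [n xk] m; exists (m + n); split; first by lia.
by rewrite xk; [case: kappa_neq => _ _ _ ck _ /esym|lia].
Qed.

(** If the words differed, both would run to the corner [kappa] in the end, whereas a gluing uses
    two distinct corner indices. *)
Lemma omega_close x y : in_Omega kappa x -> in_Omega kappa y ->
  (forall k, close R x y k) -> x = y.
Proof.
move=> [m xk] [n yk] cl; apply: functional_extensionality.
suff ag k : agree x y k by move=> i; apply: (ag i.+1).
elim: k => [//|k IH] i; rewrite ltnS leq_eqVlt => /orP[/eqP->|/IH//].
case: (eqVneq (x k) (y k)) => // /eqP d.
have [|p [q [[u [v [Puv pv pu]]] runs]]] := close_diff (cl (k + m + n).+2) IH d.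
  by lia.
have [] := runs (k + m + n).+1; first by lia.
rewrite xk; last lia; rewrite yk; last lia; move=> pk qk.
rewrite -pk in pv; rewrite -qk in pu; have uv := pos_inj pu pv; subst v.
by case: (P_diag Puv).
Qed.

Lemma rearr_distortion x y : in_Omega kappa x -> in_Omega kappa y ->
  dist_le (T M x y) (T M' (f x) (f y)) 5.
Proof.
move=> /omega_escapes ex /omega_escapes ey.
have [ak tk ca ck ct] := kappa_neq.
have P'_fun u v u' v' i j : P M' u v i j -> P M' u' v' i j -> u = u' /\ v = v'.
  by move=> /P'E[Puv _ _] /P'E[Puv' _ _]; apply: P_fun Puv'.
have pos'_letter u : exists p, pos M' u = inl p by rewrite pos'; apply: pos_has_letter.
apply: dist_le_T => k.
  move=> /(run_close P_fun pos_has_letter) cl.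
  apply/(run_close P'_fun pos'_letter).
  apply: close_sub (rearr_close ak tk ca ck ct gluing_M gluing_fun gluing_tau
    gluing_tau_kappa ex ey cl) => *; exact/corner_gluing_M'.
move=> /(run_close P'_fun pos'_letter) cl.
apply/(run_close P_fun pos_has_letter).
apply: (close_rearr ak tk ca ck ct gluing_M gluing_fun gluing_tau
    gluing_kappa_tau ex ey).
by apply: close_sub cl => *; apply/corner_gluing_M'.
Qed.

(** Equal images are close to every length, so by the distortion bound the words are too. *)
Lemma rearr_inj x y : in_Omega kappa x -> in_Omega kappa y -> f x = f y -> x = y.
Proof.
move=> ox oy fxy; apply: omega_close => // k.
have [ak tk ca ck ct] := kappa_neq.
apply: (close_rearr ak tk ca ck ct gluing_M gluing_fun gluing_tau
    gluing_kappa_tau); try exact: omega_escapes.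
by left=> i _; rewrite fxy.
Qed.

Lemma rearr_surj y : in_Omega kappa y -> exists x, in_Omega kappa x /\ f x = y.
Proof.
have [ak tk ca ck ct] := kappa_neq.
move=> [n yk].
(* [ext] and [res] identify the words equal to [kappa] from rank [n] on with a finite type, on which
   an injective self-map has an inverse. *)
pose ext (h : {ffun 'I_n -> 'I_N}) : word N := fun i => oapp h kappa (insub i).
pose res (x : word N) : {ffun 'I_n -> 'I_N} := [ffun i => x (val i)].
have extk h i : n <= i -> ext h i = kappa.
  by move=> ni; rewrite /ext insubF // ltnNge ni.
have ext_omega h : in_Omega kappa (ext h) by exists n; apply: extk.
have ext_res (x : word N) : (forall i, n <= i -> x i = kappa) -> ext (res x) = x.
  move=> xk; apply: functional_extensionality => i.
  rewrite /ext; case: insubP => [j _ ji|]; first by rewrite /= ffunE ji.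
  by rewrite -leqNgt /= => /xk.
have fk h i : n <= i -> f (ext h) i = kappa.
  by apply: rearr_eventually => //; apply: extk.
have res_inj : injective (fun h => res (f (ext h))).
  move=> h h' /(congr1 ext); rewrite !ext_res; try exact: fk.
  move=> /rearr_inj hh'; have {}hh' := hh' (ext_omega h) (ext_omega h').
  apply/ffunP => i; have := congr1 (fun x => x (val i)) hh'.
  by rewrite /ext !valK.
exists (ext (invF res_inj (res y))); split=> //.
have := congr1 ext (f_invF res_inj (res y)).
by rewrite (ext_res y) // ext_res //; apply: fk.
Qed.

Lemma rearr_bijection : exists g : word N -> word N,
  [/\ (forall x, in_Omega kappa x -> in_Omega kappa (g x)),
      (forall x y, in_Omega kappa x -> in_Omega kappa y -> g x = g y -> x = y),
      (forall y, in_Omega kappa y -> exists x, in_Omega kappa x /\ g x = y) &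
      (forall x y, in_Omega kappa x -> in_Omega kappa y ->
         dist_le (T M x y) (T M' (g x) (g y)) 5)].
Proof.
have [ak tk ca ck ct] := kappa_neq.
exists f; split; [|exact: rearr_inj|exact: rearr_surj|exact: rearr_distortion].
by move=> x [n xk]; exists n; apply: rearr_eventually.
Qed.

End Omega.

(** * Gasket automata satisfy the gluing hypotheses *)

Definition o0 : 'I_3 := @Ordinal 3 0 isT.
Definition o1 : 'I_3 := @Ordinal 3 1 isT.
Definition o2 : 'I_3 := @Ordinal 3 2 isT.

Lemma ord3_cases (u : 'I_3) : [\/ u = o0, u = o1 | u = o2].
Proof.
by case: u => [[|[|[|u]]] hu] //; [constructor 1|constructor 2|constructor 3];
  apply: val_inj.
Qed.

Lemma P_swap N (M : triangle N) u v i j : P M u v i j = P M v u j i.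
Proof. by case: (ord3_cases u) => ->; case: (ord3_cases v) => ->. Qed.

Lemma P_same N (M : triangle N) u i j : ~ P M u u i j.
Proof. by case: (ord3_cases u) => ->. Qed.

(** Uniqueness makes [kappa] the only successor of [tau] in its relation, and gathering makes any
    successor of [tau] in the other gamma-relation the letter lambda. So exactly the pairs at the
    gamma-corner of [tau] disappear. *)
Lemma simplifyE N (M : triangle N) tau kappa u v i j :
  triangle_ok M -> gasket M -> P_ag M tau kappa || P_bg M tau kappa ->
  P (simplify M tau kappa) u v i j =
  [&& P M u v i j, ~~ ((i == tau) && (v == o2)) & ~~ ((j == tau) && (u == o2))].
Proof.
move=> [_ _ _ _ func] [uniq gath _] tk.
suff [drop_ab drop_ag drop_bg] :
    [/\ P_ab (simplify M tau kappa) = P_ab M,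
        forall i j, P_ag (simplify M tau kappa) i j = P_ag M i j && (i != tau) &
        forall i j, P_bg (simplify M tau kappa) i j = P_bg M i j && (i != tau)].
  by case: (ord3_cases u) => ->; case: (ord3_cases v) => ->;
    rewrite /P /= ?drop_ab ?drop_ag ?drop_bg ?andbF ?andbT.
rewrite /simplify; case: ifP tk => /= [ag _|_ bg]; split=> // k l;
  case: (eqVneq k tau) => [->|] //=; rewrite andbF; apply/negbTE; rewrite negb_and negbK
    -implybE;
  apply/implyP.
- by move=> agl; rewrite (uniq o0 o2 tau l kappa).
- by case: (gath tau l kappa) => g1 _ _; apply: g1.
- by case: (gath tau kappa l) => g1 _ _ /g1; apply.
- by move=> bgl; rewrite (uniq o1 o2 tau l kappa).
Qed.

Theorem theorem5p1 (N : nat) (M : triangle N) (tau kappa : 'I_N) :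
  triangle_ok M -> gasket M -> gamma_isolated M ->
  (exists i j, P_ag M i j || P_bg M i j) ->
  (P_ag M tau kappa || P_bg M tau kappa) -> double_maximal M kappa ->
  exists g : word N -> word N,
    [/\ (forall x, in_Omega kappa x -> in_Omega kappa (g x)),
        (forall x y, in_Omega kappa x -> in_Omega kappa y -> g x = g y -> x = y),
        (forall y, in_Omega kappa y -> exists x, in_Omega kappa x /\ g x = y) &
        (forall x y, in_Omega kappa x -> in_Omega kappa y ->
           dist_le (T M x y) (T (simplify M tau kappa) (g x) (g y)) 5)].
Proof.
move=> ok gas [a [b [c [pa pb pc _ [[ag_c c_ag] [bg_c c_bg] [ab_c c_ab]]]]]] _ tk [dag dbg].
have [nab nac nbc irr func] := ok.
have [uniq gath [bda bdb bdc]] := gas.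
have ab : a <> b by congruence.
have ac : a <> c by congruence.
have bc : b <> c by congruence.
have P_uniq u v i j j' : P M u v i j -> P M u v i j' -> j = j'.
  by move=> Pj; apply: uniq (Pj); apply/eqP => uv; subst v; apply: P_same Pj.
have P_irr u v i : ~ P M u v i i by apply/negP.
have P_sym u v i j : P M u v i j -> P M v u j i by rewrite P_swap.
(* Boundary condition: the letter at [v] is [vu]-minimal, hence has no [uv]-successor. *)
have P_corner u v i j : P M u v i j -> pos M v <> inl i.
  case: (ord3_cases u) => ->; case: (ord3_cases v) => -> //; rewrite /P /pos /= => Pij p.
  - by have [_ /(_ j)/negP] := bdb _ p.
  - by have [/(_ j)/negP] := bdc _ p.
  - by have [_ /(_ j)/negP] := bda _ p.
  - by have [_ /(_ j)/negP] := bdc _ p.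
  - by have [/(_ j)/negP] := bda _ p.
  - by have [/(_ j)/negP] := bdb _ p.
have P_c u v j : ~ P M u v c j.
  by case: (ord3_cases u) => ->; case: (ord3_cases v) => ->; apply/negP; rewrite /P /=.
have P_kappa u j : ~ P M u o2 kappa j.
  by case: (ord3_cases u) => ->; apply/negP; rewrite /P /=.
have pos' u : pos (simplify M tau kappa) u = pos M u.
  by rewrite /simplify /pos; case: ifP.
have simplifyP u v i j : P (simplify M tau kappa) u v i j <->
    [/\ P M u v i j, ~ (i = tau /\ v = o2) & ~ (j = tau /\ u = o2)].
  rewrite simplifyE //; split=> [/and3P[-> /negP n1 /negP n2]|[Pij n1 n2]].
    by split=> // -[/eqP k1 /eqP k2]; [apply: n1|apply: n2]; rewrite k1.
  by apply/and3P; split=> //; apply/negP => /andP[/eqP k1 /eqP k2]; [apply: n1|apply: n2].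
case/orP: tk => tk.
- apply: (@rearr_bijection N M _ tau kappa o0 o1 o2 a b c) => //.
  + exact: ord3_cases.
  + exact: P_same.
  + by move=> i j l; case: (gath i l j) => H _ _; rewrite /P /=; apply: H.
  + by move=> i j l; case: (gath i l j) => _ H _; rewrite /P /=; apply: H.
(* The same argument with alpha and beta exchanged; gathering is symmetric under this exchange. *)
- apply: (@rearr_bijection N M _ tau kappa o1 o0 o2 b a c) => //.
  + by move=> u; case: (ord3_cases u) => ->; [constructor 2|constructor 1|constructor 3].
  + by move=> /esym.
  + exact: P_same.
  + by move=> i j l bg ag; case: (gath i j l) => H _ _; apply: H.
  + by move=> i j l bg ab'; case: (gath i j l) => _ _ H; apply: H bg ab'.
Qed.
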